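(* Let $A\in\mathbb{C}^{n\times n}$, let $B=B^H\in\mathbb{C}^{n\times n}$ be Hermitian positive definite, and let $R$ be the upper triangular Cholesky factor of $B$, so that $B=R^HR$. Let $\widehat U_B,\widehat V_B\in\mathbb{C}^{n\times n}$ and $\widehat\Sigma=\mathrm{diag}(\widehat\sigma_1,\dots,\widehat\sigma_n)\in\mathbb{R}^{n\times n}$ with $\widehat\sigma_1\ge\cdots\ge\widehat\sigma_n\ge 0$ be given (approximate factors of the decomposition described in the context, with no assumption on the quality of the approximation other than the bounds below). Define $$\delta=\|\widehat U_B^{H}A\widehat V_B-\widehat\Sigma\|.$$ Assume that $\alpha,\beta$ are real numbers with $$\|\widehat U_B^HB\widehat U_B-I\|\leq\alpha<1,\qquad \|\widehat V_B^HB\widehat V_B-I\|\leq\beta<1.$$ Then, with $\sigma_i:=\sigma_i(R^{-H}AR^{-1})$, $$\frac{\widehat\sigma_i-\delta}{\sqrt{(1+\alpha)(1+\beta)}}\leq\sigma_i\leq\frac{\widehat\sigma_i+\delta}{\sqrt{(1-\alpha)(1-\beta)}}\qquad\text{for all }1\leq i\leq n.$$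
   Context: For a matrix $M\in\mathbb{C}^{n\times n}$, $\sigma_i(M)$ denotes its $i$th largest singular value, $\sigma_1(M)\ge\cdots\ge\sigma_n(M)$, $M^H$ is the conjugate transpose, $R^{-H}=(R^H)^{-1}$, and $\|\cdot\|$ is the spectral norm. $I$ is the identity matrix. The exact decomposition being approximated is $AV_B=BU_B\Sigma$ with $U_B^HBU_B=V_B^HBV_B=I$, where $\Sigma$ is diagonal with entries $\sigma_i(R^{-H}AR^{-1})$ in nonincreasing order; it is obtained from a singular value decomposition $R^{-H}AR^{-1}=U\Sigma V^H$ by $U_B=R^{-1}U$, $V_B=R^{-1}V$. The matrices $\widehat U_B,\widehat\Sigma,\widehat V_B$ are computed (inexact) versions of $U_B,\Sigma,V_B$. *)

(* Defs.v *)
From mathcomp Require Import all_boot all_order all_algebra.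
From mathcomp Require Import classical_sets reals complex.

Set Implicit Arguments.
Unset Strict Implicit.
Unset Printing Implicit Defensive.

Import Order.TTheory GRing.Theory Num.Theory.

Local Open Scope ring_scope.
Local Open Scope complex_scope.
Local Open Scope sesquilinear_scope.
Local Open Scope classical_set_scope.

(* The order of [F[i]] is partial: [0 < z] says that [z] is real and positive,
   so both inequalities below include the reality of the left-hand side. *)

Definition posdefmx (F : realType) (n : nat) (B : 'M[F[i]]_n) : Prop :=
  B \is hermsymmx /\
  forall x : 'cV[F[i]]_n, x != 0 -> 0 < (x ^t* *m B *m x) 0 0.

(* [is_trig_mx] means lower triangular, hence the transpose. *)
Definition cholesky (F : realType) (n : nat) (B R : 'M[F[i]]_n) : Prop :=
  [/\ is_trig_mx R^T, forall i, 0 < R i i & B = R ^t* *m R].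

Definition l2norm (F : realType) (n : nat) (x : 'cV[F[i]]_n) : F :=
  Num.sqrt (\sum_i complex.Re `|x i 0| ^+ 2).

(* The matrix norm induced by the Euclidean norm; the closed unit ball is used
   rather than the sphere so that the set is nonempty also for [n = 0]. *)
Definition specnorm (F : realType) (m n : nat) (M : 'M[F[i]]_(m, n)) : F :=
  sup [set l2norm (M *m x) | x in [set x : 'cV[F[i]]_n | l2norm x <= 1]].

(* The roots of the characteristic polynomial, repeated according to their
   algebraic multiplicity, in an unspecified order. *)
Definition eigenvals (F : realType) (n : nat) (M : 'M[F[i]]_n) : seq F[i] :=
  sval (closed_field_poly_normal (char_poly M)).

(* The eigenvalues of [M ^t* *m M] are real and nonnegative, so taking the real
   part loses nothing. *)
Definition singvals (F : realType) (n : nat) (M : 'M[F[i]]_n) : seq F :=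
  sort (fun x y => y <= x)
    [seq Num.sqrt (complex.Re z) | z <- eigenvals (M ^t* *m M)].

(* Indices start at 0: [singval M i] is the [i.+1]-th largest singular value. *)
Definition singval (F : realType) (n : nat) (M : 'M[F[i]]_n) (i : 'I_n) : F :=
  nth 0 (singvals M) i.

(* Main.v *)
Require Import Defs.
From mathcomp Require Import all_boot all_order all_algebra.
From mathcomp Require Import classical_sets reals complex.

(** Put [M = R^-H A R^-1], [X = R U] and [Y = R V].  Since [B = R^H R], the
    hypotheses on [U] and [V] say that [X^H X] and [Y^H Y] are close to the
    identity, and [U^H A V = X^H M Y].  So the claim compares the singular
    values of [M] with the diagonal of a matrix [D] such that [X^H M Y - D] has
    norm [delta], where [X] and [Y] are nearly isometric
    ([singval_perturbation]).

    The comparison goes through the two easy halves of the Courant-Fischer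
    principle: if [M] stretches every vector of a subspace of dimension [i+1]
    by at least [c], then [c] is at most the singular value of index [i]
    ([ler_singval]); if it stretches every vector of a subspace of dimension
    [n-i] by at most [c], the opposite inequality holds ([singval_ler]).  The
    subspaces used are the images under [Y] of the span of the first [i+1], or
    last [n-i], coordinate vectors.  There [|D w| >= s_i |w|], respectively
    [|D w| <= s_i |w|], hence [X^H M Y w] has norm at least
    [(s_i - delta) |w|], respectively at most [(s_i + delta) |w|].  It remains
    to trade [|X^H z|] for [|z|] and [|w|] for [|Y w|], which costs the factors
    [sqrt (1 +- alpha)] and [sqrt (1 +- beta)]: a Gram matrix within [e] of the
    identity controls [|X x|] from both sides ([l2norm_gram_le],
    [l2norm_gram_ge]), and by Cauchy-Schwarz such bounds pass to [X^H]
    ([l2norm_adjoint_le], [l2norm_adjoint_ge]). *)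

Set Implicit Arguments.
Unset Strict Implicit.
Unset Printing Implicit Defensive.

Import Order.TTheory GRing.Theory Num.Theory.

Local Open Scope ring_scope.
Local Open Scope complex_scope.
Local Open Scope sesquilinear_scope.

(** * The Euclidean norm and the operator norm *)

Lemma l2norm_ge0 (F : realType) (n : nat) (x : 'cV[F[i]]_n) : 0 <= l2norm x.
Proof. exact: sqrtr_ge0. Qed.

Lemma Re_normE (F : realType) (z : F[i]) : (complex.Re `|z|)%:C = `|z|.
Proof. by rewrite RRe_real ?normr_real. Qed.

Lemma Re_norm_ge0 (F : realType) (z : F[i]) : 0 <= complex.Re `|z|.
Proof. by rewrite -ler0c Re_normE. Qed.

Lemma sqr_Re_norm (F : realType) (z : F[i]) :
  (complex.Re `|z| ^+ 2)%:C = Num.conj z * z.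
Proof. by rewrite rmorphXn /= Re_normE normCKC. Qed.

Lemma sqr_l2norm (F : realType) (n : nat) (x : 'cV[F[i]]_n) :
  l2norm x ^+ 2 = \sum_i complex.Re `|x i 0| ^+ 2.
Proof. by rewrite sqr_sqrtr // sumr_ge0 // => i _; exact: sqr_ge0. Qed.

Lemma l2norm_dot (F : realType) (n : nat) (x : 'cV[F[i]]_n) :
  (x ^t* *m x) 0 0 = (l2norm x ^+ 2)%:C.
Proof.
rewrite sqr_l2norm rmorph_sum mxE; apply: eq_bigr => i _.
by rewrite [RHS]sqr_Re_norm !mxE.
Qed.

(** [dotmx] pairs rows; through this identity its Cauchy-Schwarz and triangle
    inequalities carry over to columns. *)
Lemma sqrtC_dotmx (F : realType) (n : nat) (x : 'cV[F[i]]_n) :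
  sqrtC (dotmx (x ^t* ) (x ^t* )) = (l2norm x)%:C.
Proof.
by rewrite dotmxE trmxCK l2norm_dot rmorphXn sqrCK // ler0c l2norm_ge0.
Qed.

Lemma l2norm_CauchySchwarz (F : realType) (n : nat) (x y : 'cV[F[i]]_n) :
  `|(x ^t* *m y) 0 0| <= (l2norm x * l2norm y)%:C.
Proof.
rewrite [leRHS]rmorphM /= -(sqrtC_dotmx x) -(sqrtC_dotmx y).
rewrite -{1}(trmxCK y) -dotmxE.
by case: (CauchySchwarz_sqrt (@dotmx _ n) (x ^t* ) (y ^t* )).
Qed.

Lemma l2normD (F : realType) (n : nat) (x y : 'cV[F[i]]_n) :
  l2norm (x + y) <= l2norm x + l2norm y.
Proof.
rewrite -lecR [leRHS]rmorphD /= -(sqrtC_dotmx x) -(sqrtC_dotmx y).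
rewrite -(sqrtC_dotmx (x + y)) linearD map_mxD.
by case: (triangle_lerif (@dotmx _ n) (x ^t* ) (y ^t* )).
Qed.

Lemma l2norm0 (F : realType) (n : nat) : l2norm (0 : 'cV[F[i]]_n) = 0.
Proof.
by rewrite /l2norm big1 ?sqrtr0 // => i _; rewrite mxE normr0 expr0n.
Qed.

Lemma l2norm_eq0 (F : realType) (n : nat) (x : 'cV[F[i]]_n) :
  l2norm x = 0 -> x = 0.
Proof.
move=> x0; have /eqP := sqr_l2norm x.
rewrite x0 expr2 mul0r eq_sym psumr_eq0 => [/allP h|i _]; last exact: sqr_ge0.
apply/colP => i; rewrite mxE; apply/eqP; have := h i (mem_index_enum _).
by rewrite sqrf_eq0 => /eqP xi0; rewrite -normr_eq0 -(Re_normE (x i 0)) xi0.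
Qed.

Lemma l2normZ (F : realType) (n : nat) (a : F[i]) (x : 'cV[F[i]]_n) :
  l2norm (a *: x) = complex.Re `|a| * l2norm x.
Proof.
rewrite -[X in X * _](ger0_norm (Re_norm_ge0 a)) -sqrtr_sqr.
rewrite -sqrtrM ?sqr_ge0 // mulr_sumr; congr Num.sqrt.
by apply: eq_bigr => i _; rewrite mxE -exprMn -Normc.normcM.
Qed.

Lemma l2normN (F : realType) (n : nat) (x : 'cV[F[i]]_n) :
  l2norm (- x) = l2norm x.
Proof. by congr Num.sqrt; apply: eq_bigr => i _; rewrite mxE normrN. Qed.

(** Cauchy-Schwarz row by row: the Frobenius norm is such a [K]. *)
Lemma l2norm_mulmx_bounded (F : realType) (m n : nat) (M : 'M[F[i]]_(m, n)) :
  exists K, forall x, l2norm (M *m x) <= K * l2norm x.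
Proof.
pose r i := l2norm ((row i M) ^t* ).
exists (Num.sqrt (\sum_i r i ^+ 2)) => x.
have S0 : 0 <= \sum_i r i ^+ 2 by apply: sumr_ge0 => i _; exact: sqr_ge0.
rewrite -(ler_pXn2r (n := 2)) ?nnegrE ?mulr_ge0 ?sqrtr_ge0 ?l2norm_ge0 //.
rewrite exprMn (sqr_sqrtr S0) sqr_l2norm mulr_suml; apply: ler_sum => i _.
rewrite -exprMn ler_pXn2r ?nnegrE ?Re_norm_ge0 ?mulr_ge0 ?l2norm_ge0 //.
rewrite -lecR Re_normE.
have := l2norm_CauchySchwarz ((row i M) ^t* ) x.
by rewrite trmxCK -row_mul mxE.
Qed.

(** The supremum that defines [specnorm] is thus an honest one: [sup] takes a
    default value on unbounded sets. *)
Lemma specnorm_has_ubound (F : realType) (m n : nat) (M : 'M[F[i]]_(m, n)) :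
  has_ubound [set l2norm (M *m x) |
    x in [set x : 'cV[F[i]]_n | l2norm x <= 1]]%classic.
Proof.
have [K hK] := l2norm_mulmx_bounded M.
exists `|K| => _ [y /= y1 <-]; apply: (le_trans (hK y)).
apply: (le_trans (ler_norm _)); rewrite normrM (ger0_norm (l2norm_ge0 _)).
by rewrite ler_piMr.
Qed.

Lemma specnorm_ge0 (F : realType) (m n : nat) (M : 'M[F[i]]_(m, n)) :
  0 <= specnorm M.
Proof.
apply: ub_le_sup; first exact: specnorm_has_ubound.
by exists 0; rewrite /= ?mulmx0 l2norm0.
Qed.

Lemma le_specnorm (F : realType) (m n : nat) (M : 'M[F[i]]_(m, n)) x :
  l2norm (M *m x) <= specnorm M * l2norm x.
Proof.
have [/eqP/l2norm_eq0 ->|x0] := boolP (l2norm x == 0).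
  by rewrite mulmx0 !l2norm0 mulr0.
have xp : 0 < l2norm x by rewrite lt_neqAle eq_sym x0 l2norm_ge0.
rewrite -ler_pdivrMr //.
set c := (l2norm x)^-1.
have c0 : complex.Re `|c%:C| = c.
  by apply: complexI; rewrite Re_normE ger0_norm // ler0c invr_ge0 ltW.
rewrite mulrC -[c in c * _]c0 -l2normZ scalemxAr.
apply: ub_le_sup; first exact: specnorm_has_ubound.
by exists (c%:C *: x) => //=; rewrite l2normZ c0 mulVf.
Qed.

(** * Linear algebra *)

Lemma adjoint_mul (F : realType) (m n p : nat) (M : 'M[F[i]]_(m, n))
    (N : 'M[F[i]]_(n, p)) : (M *m N) ^t* = N ^t* *m M ^t*.
Proof. by rewrite trmx_mul map_mxM. Qed.

Lemma unitmx_ker0 (K : fieldType) (n : nat) (N : 'M[K]_n) :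
  (forall x : 'cV_n, N *m x = 0 -> x = 0) -> N \in unitmx.
Proof.
move=> kerN; rewrite -unitmx_tr unitmxE unitfE; apply/det0P => -[v v0 vN].
move/eqP: v0; apply; rewrite -[v]trmxK (kerN (v^T)) ?trmx0 //.
by rewrite -[N]trmxK -trmx_mul vN trmx0.
Qed.

Lemma char_poly_conj (K : fieldType) (n : nat) (P D : 'M[K]_n) :
  P \in unitmx -> char_poly (invmx P *m D *m P) = char_poly D.
Proof.
move=> uP; rewrite /char_poly.
have -> : char_poly_mx (invmx P *m D *m P) =
    map_mx polyC (invmx P) *m char_poly_mx D *m map_mx polyC P.
  rewrite /char_poly_mx mulmxBr mulmxBl -!map_mxM; congr (_ - _).
  rewrite -mulmxA mul_scalar_mx -scalemxAr -map_mxM.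
  by rewrite mulVmx // map_mx1 scalemx1.
by rewrite !det_mulmx mulrAC -det_mulmx -map_mxM mulVmx // map_mx1 det1 mul1r.
Qed.

(** A dimension count: the span of the coordinate vectors in [S] and the space
    of the [w] with [C w] supported in [T] meet nontrivially.  Only
    [#|~: T| < #|S|] equations constrain the [#|S|] free coordinates. *)
Lemma supported_kernel (K : fieldType) (n : nat) (C : 'M[K]_n)
    (S T : {set 'I_n}) : (n < #|S| + #|T|)%N ->
  exists w : 'cV[K]_n, [/\ w != 0, forall j, j \notin S -> w j 0 = 0
    & forall j, j \notin T -> (C *m w) j 0 = 0].
Proof.
move=> ltn.
pose N := \matrix_(a < #|S|, b < #|~: T|) C (enum_val b) (enum_val a).
have : kermx N != 0.
  rewrite kermx_eq0 /row_free neq_ltn; apply/orP; left.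
  apply: leq_ltn_trans (rank_leq_col N) _.
  by rewrite -(ltn_add2r #|T|) addnC cardsC card_ord.
move=> /rowV0Pn[v /sub_kermxP vN v0].
pose w : 'cV[K]_n := \col_j \sum_a v 0 a * (enum_val a == j)%:R.
have wS a : w (enum_val a) 0 = v 0 a.
  rewrite mxE (bigD1 a) //= eqxx mulr1 big1 ?addr0 // => b ba.
  by rewrite (inj_eq enum_val_inj) (negbTE ba) mulr0.
exists w; split.
- apply: contraNneq v0 => w0; apply/eqP/rowP => a.
  by rewrite -wS w0 !mxE.
- move=> j jS; rewrite mxE big1 // => a _.
  by case: eqP => [aj|_]; [rewrite -aj enum_valP in jS | rewrite mulr0].
- move=> j jT; have jT' : j \in ~: T by rewrite inE.
  have := congr1 (fun u : 'rV__ => u 0 (enum_rank_in jT' j)) vN.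
  rewrite [RHS]mxE => <-; rewrite !mxE.
  under eq_bigr => k _ do rewrite mxE mulr_sumr.
  rewrite exchange_big; apply: eq_bigr => a _ /=.
  rewrite mxE enum_rankK_in // (bigD1 (enum_val a)) //= eqxx mulr1 big1.
    by rewrite addr0 mulrC.
  by move=> k ka; rewrite eq_sym (negbTE ka) !mulr0.
Qed.

(** * Spectral description of the singular values *)

Lemma count_ge_nth (F : realType) (s : seq F) (k : nat) :
  sorted (fun x y => y <= x) s -> (k < size s)%N ->
  (k < count (fun x => nth 0 s k <= x)%R s)%N.
Proof.
move=> ss ks; rewrite -{2}(cat_take_drop k.+1 s) count_cat.
apply: leq_trans (leq_addr _ _).
have tr : transitive (fun x y : F => y <= x).
  by move=> y x z /= xy /le_trans; apply.
rewrite -[X in (X <= _)%N](size_takel ks).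
suff : all (fun x => nth 0 s k <= x) (take k.+1 s).
  by rewrite all_count => /eqP ->.
apply/(all_nthP 0) => j; rewrite size_takel // => jk; rewrite nth_take //.
by apply: (sorted_leq_nth tr) => //; rewrite inE (leq_ltn_trans _ ks).
Qed.

Lemma count_le_nth (F : realType) (s : seq F) (k : nat) :
  sorted (fun x y => y <= x) s ->
  (size s - k <= count (fun x => x <= nth 0 s k)%R s)%N.
Proof.
move=> ss; rewrite -{3}(cat_take_drop k s) count_cat.
apply: leq_trans (leq_addl _ _).
have tr : transitive (fun x y : F => y <= x).
  by move=> y x z /= xy /le_trans; apply.
rewrite -size_drop.
suff : all (fun x => x <= nth 0 s k) (drop k s).
  by rewrite all_count => /eqP ->.
apply/(all_nthP 0) => j; rewrite size_drop ltn_subRL => jk; rewrite nth_drop.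
apply: (sorted_leq_nth tr) => //; rewrite ?inE ?leq_addr //.
exact: leq_ltn_trans (leq_addr _ _) jk.
Qed.

(** [eigenvals] is an arbitrary list of roots, so it is only determined up to
    order. *)
Lemma eigenvals_conj_diag (F : realType) (n : nat) (P : 'M[F[i]]_n)
    (d : 'rV[F[i]]_n) : P \in unitmx ->
  perm_eq (eigenvals (invmx P *m diag_mx d *m P)) [seq d 0 j | j <- enum 'I_n].
Proof.
move=> uP; rewrite /eigenvals; case: closed_field_poly_normal => r /= h.
apply: prod_XsubC_eq; move: h.
rewrite (eqP (char_poly_monic _)) scale1r => <-.
rewrite char_poly_conj // char_poly_trig ?diag_mx_is_trig //.
rewrite big_map big_enum; apply: eq_bigr => j _.
by rewrite mxE eqxx.
Qed.

(** The right half of a singular value decomposition, from the spectral theorem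
    for [M^H M = P^H diag(sp) P]: the eigenvalue [sp j] is the squared norm of
    the image under [M] of the [j]-th column of [P^H], whence [d j]. *)
Lemma singvals_spectral (F : realType) (n : nat) (M : 'M[F[i]]_n) :
  exists (P : 'M[F[i]]_n) (d : 'I_n -> F),
    [/\ forall j, 0 <= d j,
        perm_eq (singvals M) [seq d j | j <- enum 'I_n],
        forall x, l2norm (M *m x) ^+ 2 =
          \sum_j d j ^+ 2 * complex.Re `|(P *m x) j 0| ^+ 2
      & forall x, l2norm (P *m x) = l2norm x].
Proof.
pose H := M ^t* *m M.
have Hadj : H ^t* = H by rewrite adjoint_mul trmxCK.
have /orthomx_spectralP : H \is normalmx by apply/normalmxP; rewrite Hadj.
have := spectral_unitarymx H.
move: (spectralmx H) (spectral_diag H) => P sp unitaryP HE.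
have uP := unitarymx_unit unitaryP.
have PV := invmx_unitary unitaryP.
pose Q := M *m P ^t*.
pose d j := l2norm (col j Q).
have spE j : sp 0 j = (d j ^+ 2)%:C.
  have -> : sp 0 j = (Q ^t* *m Q) j j.
    rewrite adjoint_mul trmxCK mulmxA -(mulmxA P) -/H HE -PV.
    by rewrite !mulmxA mulmxV // mul1mx mulmxK // mxE eqxx.
  rewrite -l2norm_dot !mxE; by apply: eq_bigr => k _; rewrite !mxE.
exists P, d; split.
- by move=> j; exact: l2norm_ge0.
- rewrite /singvals perm_sort -/H.
  apply: (perm_trans (perm_map _ _)).
    by rewrite HE; exact: eigenvals_conj_diag.
  rewrite -map_comp.
  suff /eq_map -> :
    (fun z => Num.sqrt (complex.Re z)) \o [eta sp 0] =1 d by [].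
  by move=> j /=; rewrite spE /= sqrtr_sqr ger0_norm ?l2norm_ge0.
- move=> x; apply: complexI; rewrite -l2norm_dot adjoint_mul.
  rewrite -mulmxA (mulmxA (M ^t* )) -/H HE PV -!mulmxA mulmxA -adjoint_mul.
  rewrite rmorph_sum mxE; apply: eq_bigr => j _.
  rewrite mul_diag_mx [_^t* _ _]mxE [_^T _ _]mxE [(\matrix_(_, _) _) _ _]mxE.
  by rewrite spE mulrCA -sqr_Re_norm -rmorphM.
- move=> x; apply/eqP; rewrite -(eqrXn2 (n := 2)) ?l2norm_ge0 //.
  apply/eqP/complexI; rewrite -!l2norm_dot adjoint_mul -PV.
  by rewrite -mulmxA mulKmx.
Qed.

Lemma card_set_count (F : realType) (n : nat) (p : pred F) (d : 'I_n -> F)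
    (t : seq F) : perm_eq t [seq d j | j <- enum 'I_n] ->
  #|[set j | p (d j)]| = count p t.
Proof.
move=> /permP ->; rewrite count_map cardsE cardE -size_filter.
by rewrite /enum_mem filter_predT; congr size; apply: eq_filter.
Qed.

(** How the sorted list and the spectral coordinates interact.  With repeated
    singular values the set of [j] with [d j] below a given one can be larger
    than its position tells, so only inequalities between cardinals hold, and
    they are all that a dimension count needs. *)
Lemma singval_spectral (F : realType) (n : nat) (M : 'M[F[i]]_n) (i : 'I_n) :
  exists (P : 'M[F[i]]_n) (d : 'I_n -> F),
    [/\ [/\ forall j, 0 <= d j, 0 <= singval M i,
            (n - i <= #|[set j | (d j <= singval M i)%R]|)%N
          & (i < #|[set j | (singval M i <= d j)%R]|)%N],
        forall x, l2norm (M *m x) ^+ 2 =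
          \sum_j d j ^+ 2 * complex.Re `|(P *m x) j 0| ^+ 2
      & forall x, l2norm (P *m x) = l2norm x].
Proof.
have [P [d [d0 dM normM normP]]] := singvals_spectral M.
have sz : size (singvals M) = n.
  by rewrite (perm_size dM) size_map size_enum_ord.
have sortM : sorted (fun x y => y <= x) (singvals M).
  by apply: sort_sorted => x y; rewrite orbC le_total.
exists P, d; split=> //; split=> //.
- have : singval M i \in [seq d j | j <- enum 'I_n].
    by rewrite -(perm_mem dM) mem_nth ?sz.
  by case/mapP => j _ ->.
- rewrite (card_set_count (fun x => x <= singval M i) dM).
  by have := count_le_nth i sortM; rewrite sz.
- rewrite (card_set_count (fun x => singval M i <= x) dM).
  by apply: count_ge_nth; rewrite ?sz.
Qed.

Lemma l2norm_unitmx_gt0 (F : realType) (n : nat) (C : 'M[F[i]]_n)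
    (w : 'cV[F[i]]_n) : C \in unitmx -> w != 0 -> 0 < l2norm (C *m w).
Proof.
move=> uC w0; rewrite lt_neqAle l2norm_ge0 andbT eq_sym.
apply: contraNneq w0 => /l2norm_eq0 Cw; apply/eqP.
by rewrite -[w](mulKmx uC) Cw mulmx0.
Qed.

(** * Variational bounds on singular values *)

Lemma weighted_sum_ge (F : realType) (n : nat) (d : 'I_n -> F)
    (y : 'cV[F[i]]_n) (c : F) : 0 <= c ->
    (forall j, y j 0 != 0 -> c <= d j) ->
  (c * l2norm y) ^+ 2 <= \sum_j d j ^+ 2 * complex.Re `|y j 0| ^+ 2.
Proof.
move=> c0 cd; rewrite exprMn sqr_l2norm mulr_sumr; apply: ler_sum => j _.
have [->|yj] := eqVneq (y j 0) 0; first by rewrite normr0 expr0n /= !mulr0.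
have dj := cd j yj.
by rewrite ler_wpM2r ?sqr_ge0 // ler_pXn2r ?nnegrE // (le_trans c0).
Qed.

Lemma weighted_sum_le (F : realType) (n : nat) (d : 'I_n -> F)
    (y : 'cV[F[i]]_n) (c : F) : (forall j, 0 <= d j) ->
    (forall j, y j 0 != 0 -> d j <= c) ->
  \sum_j d j ^+ 2 * complex.Re `|y j 0| ^+ 2 <= (c * l2norm y) ^+ 2.
Proof.
move=> d0 dc; rewrite exprMn sqr_l2norm mulr_sumr; apply: ler_sum => j _.
have [->|yj] := eqVneq (y j 0) 0; first by rewrite normr0 expr0n /= !mulr0.
have dj := dc j yj.
by rewrite ler_wpM2r ?sqr_ge0 // ler_pXn2r ?nnegrE // (le_trans (d0 j)).
Qed.

(** The lower half of Courant-Fischer.  The subspace is the image under [C] of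
    the vectors supported in [S]; it meets the span of the right singular
    vectors of singular value at most [singval M i], where [M] stretches by no
    more than that. *)
Lemma ler_singval (F : realType) (n : nat) (M C : 'M[F[i]]_n)
    (S : {set 'I_n}) (c : F) (i : 'I_n) : C \in unitmx -> (i < #|S|)%N ->
    (forall w : 'cV_n, (forall j, j \notin S -> w j 0 = 0) ->
       c * l2norm (C *m w) <= l2norm (M *m (C *m w))) ->
  c <= singval M i.
Proof.
move=> uC iS hS.
have [P [d [[d0 sig0 T_big _] normM normP]]] := singval_spectral M i.
have [|w [w0 wS wT]] :=
    @supported_kernel _ _ (P *m C) S [set j | d j <= singval M i].
  by rewrite -{1}(subnKC (ltnW (ltn_ord i))) -addSn leq_add.
rewrite -(ler_pM2r (l2norm_unitmx_gt0 uC w0)) (le_trans (hS w wS)) //.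
rewrite -(ler_pXn2r (n := 2)) ?nnegrE ?mulr_ge0 ?l2norm_ge0 //.
rewrite normM -(normP (C *m w)); apply: weighted_sum_le => // j.
by rewrite mulmxA; apply: contraNT => dj; rewrite wT // inE.
Qed.

(** The upper half, by the same argument with the right singular vectors of
    singular value at least [singval M i]. *)
Lemma singval_ler (F : realType) (n : nat) (M C : 'M[F[i]]_n)
    (S : {set 'I_n}) (c : F) (i : 'I_n) : C \in unitmx -> (n - i <= #|S|)%N ->
    (forall w : 'cV_n, (forall j, j \notin S -> w j 0 = 0) ->
       l2norm (M *m (C *m w)) <= c * l2norm (C *m w)) ->
  singval M i <= c.
Proof.
move=> uC iS hS.
have [P [d [[d0 sig0 _ T_big] normM normP]]] := singval_spectral M i.
have [|w [w0 wS wT]] :=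
    @supported_kernel _ _ (P *m C) S [set j | singval M i <= d j].
  by rewrite -{1}(subnK (ltnW (ltn_ord i))) -addnS leq_add.
rewrite -(ler_pM2r (l2norm_unitmx_gt0 uC w0)) (le_trans _ (hS w wS)) //.
rewrite -(ler_pXn2r (n := 2)) ?nnegrE ?mulr_ge0 ?l2norm_ge0 //.
rewrite normM -(normP (C *m w)); apply: weighted_sum_ge => // j.
by rewrite mulmxA; apply: contraNT => dj; rewrite wT // inE.
Qed.

(** * Matrices with a Gram matrix close to the identity *)

(** The difference of squares is the inner product of [x] with
    [(X^H X - 1) x]. *)
Lemma l2norm_gram (F : realType) (m n : nat) (X : 'M[F[i]]_(m, n))
    (e : F) : specnorm (X ^t* *m X - 1%:M) <= e ->
  forall x, `|l2norm (X *m x) ^+ 2 - l2norm x ^+ 2| <= e * l2norm x ^+ 2.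
Proof.
move=> hX x; set E := _ - _ in hX.
have xEx : (x ^t* *m (E *m x)) 0 0 = (l2norm (X *m x) ^+ 2 - l2norm x ^+ 2)%:C.
  rewrite [RHS]rmorphB /= -!l2norm_dot mulmxBl mul1mx mulmxBr.
  by rewrite adjoint_mul !mulmxA [LHS]mxE [(- _ : 'M__) _ _]mxE.
rewrite -lecR; apply: (@le_trans _ _ (l2norm x * l2norm (E *m x))%:C).
  apply: le_trans (l2norm_CauchySchwarz x (E *m x)); rewrite xEx.
  by rewrite normc_def /= expr0n addr0 sqrtr_sqr.
rewrite lecR mulrC expr2 mulrA ler_wpM2r ?l2norm_ge0 //.
by rewrite (le_trans (le_specnorm _ _)) // ler_wpM2r ?l2norm_ge0.
Qed.

Lemma l2norm_gram_le (F : realType) (m n : nat) (X : 'M[F[i]]_(m, n))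
    (e : F) : specnorm (X ^t* *m X - 1%:M) <= e ->
  forall x, l2norm (X *m x) <= Num.sqrt (1 + e) * l2norm x.
Proof.
move=> hX x.
have e0 : 0 <= 1 + e by rewrite addr_ge0 // (le_trans _ hX) ?specnorm_ge0.
rewrite -(ler_pXn2r (n := 2)) ?nnegrE ?mulr_ge0 ?sqrtr_ge0 ?l2norm_ge0 //.
have := l2norm_gram hX x; rewrite ler_distl exprMn (sqr_sqrtr e0) mulrDl mul1r.
by case/andP.
Qed.

Lemma l2norm_gram_ge (F : realType) (m n : nat) (X : 'M[F[i]]_(m, n))
    (e : F) : specnorm (X ^t* *m X - 1%:M) <= e -> e < 1 ->
  forall x, Num.sqrt (1 - e) * l2norm x <= l2norm (X *m x).
Proof.
move=> hX e1 x.
have e0 : 0 <= 1 - e by rewrite subr_ge0 ltW.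
rewrite -(ler_pXn2r (n := 2)) ?nnegrE ?mulr_ge0 ?sqrtr_ge0 ?l2norm_ge0 //.
have := l2norm_gram hX x; rewrite ler_distl exprMn (sqr_sqrtr e0) mulrBl mul1r.
by case/andP.
Qed.

Lemma l2norm_gram_unitmx (F : realType) (n : nat) (X : 'M[F[i]]_n)
    (e : F) : specnorm (X ^t* *m X - 1%:M) <= e -> e < 1 -> X \in unitmx.
Proof.
move=> hX e1; apply: unitmx_ker0 => x Xx0; apply: l2norm_eq0.
have := l2norm_gram_ge hX e1 x.
rewrite Xx0 l2norm0 pmulr_rle0 ?sqrtr_gt0 ?subr_gt0 // => x0.
by apply/eqP; rewrite eq_le x0 l2norm_ge0.
Qed.

(** Cauchy-Schwarz in the form in which adjoints use it: a squared norm can be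
    rewritten as another inner product by moving a matrix across. *)
Lemma l2norm_dot_le (F : realType) (m n : nat) (x : 'cV[F[i]]_m)
    (y z : 'cV[F[i]]_n) :
  x ^t* *m x = y ^t* *m z -> l2norm x ^+ 2 <= l2norm y * l2norm z.
Proof.
move=> xyz; rewrite -lecR (le_trans _ (l2norm_CauchySchwarz y z)) //.
rewrite -xyz l2norm_dot normc_def /= expr0n addr0 sqrtr_sqr.
by rewrite ger0_norm ?sqr_ge0.
Qed.

(** [|X^H z|^2] is the inner product of [X (X^H z)] and [z]. *)
Lemma l2norm_adjoint_le (F : realType) (m n : nat) (X : 'M[F[i]]_(m, n))
    (K : F) : 0 <= K -> (forall x, l2norm (X *m x) <= K * l2norm x) ->
  forall z, l2norm (X ^t* *m z) <= K * l2norm z.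
Proof.
move=> K0 hX z; set u := _ *m z.
have [u0|u0] := eqVneq (l2norm u) 0.
  by rewrite u0 mulr_ge0 ?l2norm_ge0.
have up : 0 < l2norm u by rewrite lt_neqAle eq_sym u0 l2norm_ge0.
rewrite -(ler_pM2r up) -expr2 mulrAC.
apply: (@le_trans _ _ (l2norm (X *m u) * l2norm z)); last first.
  by rewrite ler_wpM2r ?l2norm_ge0.
by apply: l2norm_dot_le; rewrite (adjoint_mul X) -mulmxA.
Qed.

(** Writing [z = X w], [|z|^2] is the inner product of [w] and [X^H z], and
    [k |w| <= |z|]. *)
Lemma l2norm_adjoint_ge (F : realType) (n : nat) (X : 'M[F[i]]_n)
    (k : F) : X \in unitmx -> 0 <= k ->
    (forall x, k * l2norm x <= l2norm (X *m x)) ->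
  forall z, k * l2norm z <= l2norm (X ^t* *m z).
Proof.
move=> uX k0 hX z.
have [/eqP/l2norm_eq0 ->|z0] := boolP (l2norm z == 0).
  by rewrite mulmx0 !l2norm0 mulr0.
have zp : 0 < l2norm z by rewrite lt_neqAle eq_sym z0 l2norm_ge0.
have zE : X *m (invmx X *m z) = z by rewrite mulKVmx.
set w := invmx X *m z in zE.
rewrite -(ler_pM2r zp) -mulrA -expr2.
have zz : l2norm z ^+ 2 <= l2norm w * l2norm (X ^t* *m z).
  by apply: l2norm_dot_le; rewrite -{1}zE adjoint_mul mulmxA.
have := hX w; rewrite zE => kw.
apply: (le_trans (ler_wpM2l k0 zz)).
by rewrite mulrA [leRHS]mulrC ler_wpM2r ?l2norm_ge0.
Qed.

(** * Perturbation of singular values *)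

Lemma l2norm_diag (F : realType) (n : nat) (s : 'rV[F]_n) (x : 'cV[F[i]]_n) :
  l2norm (diag_mx (map_mx (real_complex F) s) *m x) ^+ 2 =
    \sum_j s 0 j ^+ 2 * complex.Re `|x j 0| ^+ 2.
Proof.
rewrite sqr_l2norm; apply: eq_bigr => j _.
rewrite mul_diag_mx !mxE [X in X ^+ 2]Normc.normcM exprMn; congr (_ * _).
by rewrite /= expr0n addr0 sqrtr_sqr real_normK ?num_real.
Qed.

Lemma card_ord_lt (n k : nat) : (k <= n)%N -> #|[set j : 'I_n | (j < k)%N]| = k.
Proof.
move=> kn; rewrite -sum1dep_card (big_ord_narrow kn).
by rewrite sum1_card card_ord.
Qed.

(** In this form the metric given by [B] has disappeared: it has been absorbed
    into the nearly isometric factors [X] and [Y]. *)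
Lemma singval_perturbation (F : realType) (n : nat) (M X Y : 'M[F[i]]_n)
    (s : 'rV[F]_n) (delta alpha beta : F)
    (s_noninc : forall i j : 'I_n, (i <= j)%N -> s 0 j <= s 0 i)
    (s_ge0 : forall i : 'I_n, 0 <= s 0 i)
    (hdelta : specnorm (X ^t* *m M *m Y - diag_mx (map_mx (real_complex F) s))
      <= delta)
    (hX : specnorm (X ^t* *m X - 1%:M) <= alpha) (halpha : alpha < 1)
    (hY : specnorm (Y ^t* *m Y - 1%:M) <= beta) (hbeta : beta < 1)
    (i : 'I_n) :
  (s 0 i - delta) / Num.sqrt ((1 + alpha) * (1 + beta)) <= singval M i /\
  singval M i <= (s 0 i + delta) / Num.sqrt ((1 - alpha) * (1 - beta)).
Proof.
have uX := l2norm_gram_unitmx hX halpha.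
have uY := l2norm_gram_unitmx hY hbeta.
have a0 : 0 <= alpha := le_trans (specnorm_ge0 _) hX.
have b0 : 0 <= beta := le_trans (specnorm_ge0 _) hY.
have d0 : 0 <= delta := le_trans (specnorm_ge0 _) hdelta.
set D := diag_mx _ in hdelta.
have errD w : l2norm ((X ^t* *m M *m Y - D) *m w) <= delta * l2norm w.
  by apply: le_trans (le_specnorm _ _) _; rewrite ler_wpM2r ?l2norm_ge0.
split.
- set K1 := Num.sqrt (1 + alpha); set K2 := Num.sqrt (1 + beta).
  have K1p : 0 < K1 by rewrite sqrtr_gt0 ltr_pwDl.
  have K2p : 0 < K2 by rewrite sqrtr_gt0 ltr_pwDl.
  rewrite sqrtrM ?addr_ge0 // -/K1 -/K2.
  apply: (ler_singval (S := [set j : 'I_n | (j < i.+1)%N]) uY).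
    by rewrite (card_ord_lt (ltn_ord i)).
  move=> w wS; rewrite mulrAC ler_pdivrMr ?mulr_gt0 //.
  (* A negative numerator would reverse the passage from [Y w] to [w]. *)
  have [sd|sd] := leP (s 0 i - delta) 0.
    apply: (@le_trans _ _ 0).
      by rewrite mulr_le0_ge0 ?l2norm_ge0.
    by rewrite mulr_ge0 ?l2norm_ge0 // ltW ?mulr_gt0.
  apply: (@le_trans _ _ (K2 * ((s 0 i - delta) * l2norm w))).
    by rewrite mulrCA ler_wpM2l ?(ltW sd) // l2norm_gram_le.
  rewrite [leRHS]mulrA [leRHS]mulrC (ler_pM2l K2p) [leRHS]mulrC.
  apply: le_trans (l2norm_adjoint_le (ltW K1p) (l2norm_gram_le hX) _).
  rewrite mulrBl lerBlDr; apply: (@le_trans _ _ (l2norm (D *m w))).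
    rewrite -(ler_pXn2r (n := 2)) ?nnegrE ?mulr_ge0 ?l2norm_ge0 //.
    rewrite l2norm_diag; apply: weighted_sum_ge => // j wj.
    by apply: s_noninc; apply: contraNT wj => ji; rewrite wS // inE.
  have -> : D *m w = X ^t* *m (M *m (Y *m w)) - (X ^t* *m M *m Y - D) *m w.
    by rewrite mulmxBl !mulmxA subKr.
  apply: le_trans (l2normD _ _) _; rewrite l2normN lerD2l; exact: errD.
- set k1 := Num.sqrt (1 - alpha); set k2 := Num.sqrt (1 - beta).
  have k1p : 0 < k1 by rewrite sqrtr_gt0 subr_gt0.
  have k2p : 0 < k2 by rewrite sqrtr_gt0 subr_gt0.
  rewrite sqrtrM ?subr_ge0 ?(ltW halpha) // -/k1 -/k2.
  apply: (singval_ler (S := [set j : 'I_n | (i <= j)%N]) uY).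
    rewrite leq_subLR -{1}(card_ord n) -(cardsC [set j : 'I_n | (j < i)%N]).
    rewrite (card_ord_lt (ltnW (ltn_ord i))) leq_add2l subset_leq_card //.
    by apply/fintype.subsetP => j; rewrite !inE -leqNgt.
  move=> w wS; rewrite mulrAC ler_pdivlMr ?mulr_gt0 //.
  rewrite [leLHS]mulrA [leLHS]mulrC.
  apply: (@le_trans _ _ (k2 * ((s 0 i + delta) * l2norm w))); last first.
    by rewrite mulrCA ler_wpM2l ?addr_ge0 // l2norm_gram_ge.
  rewrite (ler_pM2l k2p) [leLHS]mulrC.
  apply: le_trans _ _.
    exact: (l2norm_adjoint_ge uX (ltW k1p) (l2norm_gram_ge hX halpha)).
  have -> : X ^t* *m (M *m (Y *m w)) = D *m w + (X ^t* *m M *m Y - D) *m w.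
    by rewrite mulmxBl !mulmxA addrC subrK.
  apply: le_trans (l2normD _ _) _; rewrite mulrDl lerD //.
  rewrite -(ler_pXn2r (n := 2)) ?nnegrE ?mulr_ge0 ?l2norm_ge0 //.
  rewrite l2norm_diag; apply: weighted_sum_le => // j wj.
  by apply: s_noninc; apply: contraNT wj => ji; rewrite wS // inE.
Qed.

Theorem theorem1 (F : realType) (n : nat) (A B R : 'M[F[i]]_n)
    (hB : posdefmx B) (hR : cholesky B R)
    (U V : 'M[F[i]]_n) (s : 'rV[F]_n)
    (s_noninc : forall i j : 'I_n, (i <= j)%N -> s 0 j <= s 0 i)
    (s_ge0 : forall i : 'I_n, 0 <= s 0 i)
    (delta : F)
    (hdelta : delta =
      specnorm (U ^t* *m A *m V - diag_mx (map_mx (real_complex F) s)))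
    (alpha beta : F)
    (hU : specnorm (U ^t* *m B *m U - 1%:M) <= alpha) (halpha : alpha < 1)
    (hV : specnorm (V ^t* *m B *m V - 1%:M) <= beta) (hbeta : beta < 1)
    (i : 'I_n) :
  let sigma := singval (invmx (R ^t*) *m A *m invmx R) in
  (s 0 i - delta) / Num.sqrt ((1 + alpha) * (1 + beta)) <= sigma i /\
  sigma i <= (s 0 i + delta) / Num.sqrt ((1 - alpha) * (1 - beta)).
Proof.
have [_ _ BE] := hR.
have gram W : W ^t* *m B *m W = (R *m W) ^t* *m (R *m W).
  by rewrite BE adjoint_mul !mulmxA.
(* [R U] is invertible by the bound [alpha < 1], so its factor [R] is too. *)
have uR : R \in unitmx.
  rewrite gram in hU; have := l2norm_gram_unitmx hU halpha.
  by rewrite unitmx_mul => /andP[].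
have uRa : R ^t* \in unitmx by rewrite map_unitmx unitmx_tr.
rewrite !gram in hU hV.
apply: (singval_perturbation s_noninc s_ge0 _ hU halpha hV hbeta).
have RMR : R ^t* *m (invmx (R ^t* ) *m A *m invmx R) *m R = A.
  by rewrite !mulmxA mulmxV // mul1mx mulmxKV.
move: (invmx (R ^t* ) *m A *m invmx R) RMR => M RMR.
by rewrite hdelta -RMR adjoint_mul !mulmxA.
Qed.
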